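(* Let $D_0=\{(x,y)\in\mathbb{R}^2: x^2+y^2<1\}$ be the open unit disk, let $(u,v)$ be the fibre coordinates corresponding to $(x,y)$ on the slit tangent bundle $T^\circ D_0$, and for $\tau\in\mathbb{R}$ let $$F_\tau(x,y,u,v)=\frac{\sqrt{u^2+v^2}+\tau(yu-xv)}{2(1-(x^2+y^2))}.$$ For $-1\le\tau\le 1$, $F_\tau$ is a Finsler metric over the whole of $D_0$; for $|\tau|>1$, $F_\tau$ is a Finsler metric on the smaller domain $x^2+y^2<\tau^{-2}$. For every $\tau$ the geodesics of $F_\tau$ are circles, and each geodesic of $F_\tau$ has constant geodesic curvature $\tau$ with respect to the Poincaré metric on $D_0$.
   Context: The slit tangent bundle is the tangent bundle with the zero section removed. A Finsler metric (Finsler function) is a smooth function on the slit tangent bundle, positively homogeneous of degree 1 in $(u,v)$, that is positive and strongly convex. Geodesics of $F_\tau$ are the solutions in $D_0$ of its Euler-Lagrange equations, considered as oriented paths (this makes sense also where $F_\tau$ fails to be positive). ''Circle'' means an (arc of a) Euclidean circle, with straight lines counted as circles of infinite radius. The Poincaré metric is the metric $\frac{4(dx^2+dy^2)}{(1-(x^2+y^2))^2}$ of Gaussian curvature $-1$. Geodesic curvature is signed, taken with respect to the unit normal obtained by rotating the unit tangent anticlockwise by a right angle (direction $(-\dot y,\dot x)$ for tangent $(\dot x,\dot y)$). *)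

(* Defs.v *)
(* Real analysis over the Stdlib reals, with Coquelicot. *)
From Stdlib Require Export Reals.
From Coquelicot Require Export Coquelicot.
Open Scope R_scope.

Definition D0 (x y : R) : Prop := x ^ 2 + y ^ 2 < 1.

(** * Functions on the tangent bundle of (a domain of) the plane *)

Definition slit (Om : R -> R -> Prop) (x y u v : R) : Prop :=
  Om x y /\ (u, v) <> (0, 0).

Definition dx (f : R -> R -> R -> R -> R) (x y u v : R) : R :=
  Derive (fun s => f s y u v) x.
Definition dy (f : R -> R -> R -> R -> R) (x y u v : R) : R :=
  Derive (fun s => f x s u v) y.
Definition du (f : R -> R -> R -> R -> R) (x y u v : R) : R :=
  Derive (fun s => f x y s v) u.
Definition dv (f : R -> R -> R -> R -> R) (x y u v : R) : R :=
  Derive (fun s => f x y u s) v.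

(* [Derive] is a total operator, so existence of the partial derivatives is
   required separately. *)
Fixpoint Ck (k : nat) (U : R -> R -> R -> R -> Prop)
    (f : R -> R -> R -> R -> R) : Prop :=
  (forall x y u v, U x y u v ->
     continuous (fun p : (R * R) * (R * R) =>
                   f (fst (fst p)) (snd (fst p)) (fst (snd p)) (snd (snd p)))
                ((x, y), (u, v))) /\
  match k with
  | O => True
  | S k' =>
      (forall x y u v, U x y u v ->
         ex_derive (fun s => f s y u v) x /\
         ex_derive (fun s => f x s u v) y /\
         ex_derive (fun s => f x y s v) u /\
         ex_derive (fun s => f x y u s) v) /\
      Ck k' U (dx f) /\ Ck k' U (dy f) /\ Ck k' U (du f) /\ Ck k' U (dv f)
  end.

Definition smooth (U : R -> R -> R -> R -> Prop)
    (f : R -> R -> R -> R -> R) : Prop :=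
  forall k : nat, Ck k U f.

Definition energy (F : R -> R -> R -> R -> R) (x y u v : R) : R :=
  F x y u v ^ 2 / 2.

(* The fibre Hessian of the energy, i.e. the fundamental tensor of [F], is
   positive definite. *)
Definition strongly_convex (Om : R -> R -> Prop)
    (F : R -> R -> R -> R -> R) : Prop :=
  forall x y u v, slit Om x y u v ->
  forall a b : R, (a, b) <> (0, 0) ->
    0 < du (du (energy F)) x y u v * a * a
        + du (dv (energy F)) x y u v * a * b
        + dv (du (energy F)) x y u v * b * a
        + dv (dv (energy F)) x y u v * b * b.

Record is_Finsler (Om : R -> R -> Prop) (F : R -> R -> R -> R -> R) : Prop := {
  Finsler_smooth : smooth (slit Om) F;
  Finsler_homogeneous : forall x y u v l, slit Om x y u v -> 0 < l ->
    F x y (l * u) (l * v) = l * F x y u v;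
  Finsler_positive : forall x y u v, slit Om x y u v -> 0 < F x y u v;
  Finsler_strongly_convex : strongly_convex Om F }.

(** * Geodesics *)

(* A parametrized curve t |-> (x t, y t) on the open interval (a, b), possibly
   unbounded, whose lift (x, y, x', y') stays in the slit tangent bundle and
   which solves the Euler-Lagrange equations of [F]. As [F] is homogeneous the
   parametrization is arbitrary, up to orientation. *)
Record is_geodesic (Om : R -> R -> Prop) (F : R -> R -> R -> R -> R)
    (a b : Rbar) (x y : R -> R) : Prop := {
  geodesic_regularity : forall t : R, Rbar_lt a t -> Rbar_lt t b ->
    ex_derive x t /\ ex_derive y t /\
    ex_derive (Derive x) t /\ ex_derive (Derive y) t;
  geodesic_slit : forall t : R, Rbar_lt a t -> Rbar_lt t b ->
    slit Om (x t) (y t) (Derive x t) (Derive y t);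
  geodesic_Euler_Lagrange_x : forall t : R, Rbar_lt a t -> Rbar_lt t b ->
    is_derive (fun s => du F (x s) (y s) (Derive x s) (Derive y s)) t
              (dx F (x t) (y t) (Derive x t) (Derive y t));
  geodesic_Euler_Lagrange_y : forall t : R, Rbar_lt a t -> Rbar_lt t b ->
    is_derive (fun s => dv F (x s) (y s) (Derive x s) (Derive y s)) t
              (dy F (x t) (y t) (Derive x t) (Derive y t)) }.

(* For a curve with nowhere vanishing velocity on an interval, lying on a circle
   or on a line is the same as tracing an arc of it. *)
Definition is_circle (a b : Rbar) (x y : R -> R) : Prop :=
  (exists p q r : R, 0 < r /\
     forall t : R, Rbar_lt a t -> Rbar_lt t b ->
       (x t - p) ^ 2 + (y t - q) ^ 2 = r ^ 2) \/
  (exists A B C : R, (A, B) <> (0, 0) /\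
     forall t : R, Rbar_lt a t -> Rbar_lt t b ->
       A * x t + B * y t + C = 0).

(** * Geodesic curvature *)

Inductive coord : Set := X | Y.

Definition sumc (f : coord -> R) : R := f X + f Y.

Definition metric := coord -> coord -> R -> R -> R.

Definition dcoord (i : coord) (f : R -> R -> R) (x y : R) : R :=
  match i with
  | X => Derive (fun s => f s y) x
  | Y => Derive (fun s => f x s) y
  end.

Definition metric_det (g : metric) (x y : R) : R :=
  g X X x y * g Y Y x y - g X Y x y * g Y X x y.

Definition metric_inv (g : metric) (i j : coord) (x y : R) : R :=
  match i, j with
  | X, X => g Y Y x y / metric_det g x y
  | Y, Y => g X X x y / metric_det g x y
  | _, _ => - g i j x y / metric_det g x y
  end.

(* [christoffel g k i j] is Gamma^k_{ij} of the Levi-Civita connection. *)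
Definition christoffel (g : metric) (k i j : coord) (x y : R) : R :=
  sumc (fun l => metric_inv g k l x y / 2 *
    (dcoord i (g j l) x y + dcoord j (g i l) x y - dcoord l (g i j) x y)).

Definition inner (g : metric) (x y : R) (v w : coord -> R) : R :=
  sumc (fun i => sumc (fun j => g i j x y * v i * w j)).

Definition gnorm (g : metric) (x y : R) (v : coord -> R) : R :=
  sqrt (inner g x y v v).

Definition velocity (x y : R -> R) (t : R) (i : coord) : R :=
  match i with X => Derive x t | Y => Derive y t end.

Definition cov_deriv (g : metric) (x y : R -> R) (V : R -> coord -> R)
    (t : R) (k : coord) : R :=
  Derive (fun s => V s k) t +
  sumc (fun i => sumc (fun j =>
    christoffel g k i j (x t) (y t) * velocity x y t i * V t j)).

Definition unit_tangent (g : metric) (x y : R -> R) (t : R) (i : coord) : R :=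
  velocity x y t i / gnorm g (x t) (y t) (velocity x y t).

Definition rot (v : coord -> R) (i : coord) : R :=
  match i with X => - v Y | Y => v X end.

(* The normal direction is the Euclidean rotation of the tangent; it is normal
   with respect to [g] when [g] is conformal to the Euclidean metric. *)
Definition unit_normal (g : metric) (x y : R -> R) (t : R) (i : coord) : R :=
  rot (velocity x y t) i / gnorm g (x t) (y t) (rot (velocity x y t)).

(* g(nabla_T T, N); division by the speed turns the covariant derivative along
   the parameter into that along the arc length. *)
Definition geodesic_curvature (g : metric) (x y : R -> R) (t : R) : R :=
  inner g (x t) (y t) (cov_deriv g x y (unit_tangent g x y) t)
                      (unit_normal g x y t)
  / gnorm g (x t) (y t) (velocity x y t).

Definition poincare : metric := fun i j x y =>
  match i, j with
  | X, X | Y, Y => 4 / (1 - (x ^ 2 + y ^ 2)) ^ 2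
  | _, _ => 0
  end.

(** * The family of metrics *)

Definition Ftau (tau x y u v : R) : R :=
  (sqrt (u ^ 2 + v ^ 2) + tau * (y * u - x * v)) / (2 * (1 - (x ^ 2 + y ^ 2))).

(* Main.v *)
From Stdlib Require Import Lra Psatz.
Require Import Defs.

(** Write n for the Euclidean speed, rho for 1 - (x^2 + y^2), and F for the
    function [Ftau tau].

    _Finsler property._ Both domains are discs x^2 + y^2 < c with c <= 1 and
    tau^2 c <= 1. On the slit tangent bundle of such a disc, F belongs to the
    ring generated by the coordinates, n, 1/n and 1/rho; this ring is stable
    under the partial derivatives and consists of continuous functions, so its
    elements are smooth ([represents_smooth]), and second derivatives can be
    computed formally. Positivity is the Cauchy-Schwarz inequality. For a
    function of the form norm plus linear form, the fundamental tensor evaluated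
    on a vector (a, b) is (F_u a + F_v b)^2 plus a positive multiple of
    F (v a - u b)^2. The second term vanishes only when (a, b) is proportional to
    (u, v), and then Euler's identity makes the first one nonzero
    ([Ftau_strongly_convex]).

    _Geodesics._ Let (T1, T2) be the Euclidean unit tangent and k the Euclidean
    curvature of a geodesic. The two Euler-Lagrange equations are y' and -x'
    times a single scalar equation, and since the velocity does not vanish they
    amount to k rho = 2 (tau + y T1 - x T2) ([tangent_derive]).
    Differentiating this relation with T1' = - k y' and T2' = k x' gives k' = 0
    ([kappa_constant]). A curve of constant Euclidean curvature is an arc of a
    circle or a segment: the centre (x - T2/k, y + T1/k) is fixed when k is not
    0, and the tangent is fixed when k = 0 ([geodesic_is_circle]).

    The Poincaré metric is (2/rho)^2 times the Euclidean one, and the conformal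
    change formula for the geodesic curvature reads
    k_g = (k rho)/2 - (y T1 - x T2). The scalar equation above says that
    this is tau ([geodesic_poincare_curvature]). *)

(** * A ring of functions stable under differentiation *)

Definition disc (c x y : R) : Prop := x ^ 2 + y ^ 2 < c.

Inductive bundle_coord : Set := cx | cy | cu | cv.

(** Formal expressions rather than functions: the derivatives required by [Ck]
    are then again expressions, so that one induction covers all orders.
    [InvRho] stands for the inverse of 1 - (x^2 + y^2). *)
Inductive expr : Set :=
  | Cst (c : R)
  | Var (i : bundle_coord)
  | Speed
  | InvSpeed
  | InvRho
  | Add (e f : expr)
  | Mul (e f : expr).

Fixpoint eval (e : expr) (x y u v : R) : R :=
  match e with
  | Cst c => c
  | Var cx => x
  | Var cy => y
  | Var cu => u
  | Var cv => v
  | Speed => sqrt (u ^ 2 + v ^ 2)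
  | InvSpeed => / sqrt (u ^ 2 + v ^ 2)
  | InvRho => / (1 - (x ^ 2 + y ^ 2))
  | Add e f => eval e x y u v + eval f x y u v
  | Mul e f => eval e x y u v * eval f x y u v
  end.

Definition delta (i j : bundle_coord) : R :=
  match i, j with
  | cx, cx | cy, cy | cu, cu | cv, cv => 1
  | _, _ => 0
  end.

Fixpoint partial (i : bundle_coord) (e : expr) : expr :=
  match e with
  | Cst _ => Cst 0
  | Var j => Cst (delta i j)
  | Speed =>
      match i with
      | cx | cy => Cst 0
      | _ => Mul (Var i) InvSpeed
      end
  | InvSpeed =>
      match i with
      | cx | cy => Cst 0
      | _ => Mul (Cst (-1)) (Mul (Var i) (Mul InvSpeed (Mul InvSpeed InvSpeed)))
      end
  | InvRho =>
      match i with
      | cu | cv => Cst 0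
      | _ => Mul (Cst 2) (Mul (Var i) (Mul InvRho InvRho))
      end
  | Add e f => Add (partial i e) (partial i f)
  | Mul e f => Add (Mul (partial i e) f) (Mul e (partial i f))
  end.

Lemma sum_sq_pos : forall u v : R, (u, v) <> (0, 0) -> 0 < u ^ 2 + v ^ 2.
Proof.
  intros u v H.
  destruct (Req_dec u 0) as [-> | Hu]; [ | nra ].
  destruct (Req_dec v 0) as [-> | Hv]; [ now elim H | nra ].
Qed.

Lemma sum_sq_pos_inv : forall u v : R, 0 < u ^ 2 + v ^ 2 -> (u, v) <> (0, 0).
Proof. intros u v H E; injection E; intros -> ->; lra. Qed.

Lemma sqrt_sum_sq : forall u v : R, (u, v) <> (0, 0) ->
  0 < sqrt (u ^ 2 + v ^ 2) /\ sqrt (u ^ 2 + v ^ 2) ^ 2 = u ^ 2 + v ^ 2.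
Proof.
  intros u v H; apply sum_sq_pos in H; split.
  - now apply sqrt_lt_R0.
  - apply pow2_sqrt; lra.
Qed.

Section Disc.

Variable c : R.
Hypothesis c_le_1 : c <= 1.

Let U := slit (disc c).

Lemma eval_is_derive : forall (e : expr) (x y u v : R), U x y u v ->
  is_derive (fun s => eval e s y u v) x (eval (partial cx e) x y u v) /\
  is_derive (fun s => eval e x s u v) y (eval (partial cy e) x y u v) /\
  is_derive (fun s => eval e x y s v) u (eval (partial cu e) x y u v) /\
  is_derive (fun s => eval e x y u s) v (eval (partial cv e) x y u v).
Proof.
  intros e x y u v [HO HS]; unfold disc in HO.
  pose proof (sum_sq_pos _ _ HS) as HP.
  destruct (sqrt_sum_sq _ _ HS) as [Hn Hn2].
  set (n := sqrt (u ^ 2 + v ^ 2)) in *.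
  assert (Hr : 0 < 1 - (x ^ 2 + y ^ 2)) by lra.
  induction e as [k | [] | | | | e IHe f IHf | e IHe f IHf]; simpl eval; fold n;
    (split; [ | split; [ | split ] ]).
  1-20: auto_derive; [ exact I | ring ].
  (* [auto_derive] unfolds the squares under the root. *)
  1-12: auto_derive; change (sqrt (u * (u * 1) + v * (v * 1))) with n;
    trivial; repeat split; lra || (field; lra).
  all: destruct IHe as (? & ? & ? & ?), IHf as (? & ? & ? & ?).
  1-4: refine (is_derive_plus _ _ _ _ _ _ _); assumption.
  1-4: refine (Derive.is_derive_mult _ _ _ _ _ _ _); assumption.
Qed.

Lemma eval_continuous : forall (e : expr) (x y u v : R), U x y u v ->
  continuous (fun p : (R * R) * (R * R) =>
    eval e (fst (fst p)) (snd (fst p)) (fst (snd p)) (snd (snd p)))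
    ((x, y), (u, v)).
Proof.
  intros e x y u v [HO HS]; unfold disc in HO.
  destruct (sqrt_sum_sq _ _ HS) as [Hn _].
  set (p0 := ((x, y), (u, v)) : (R * R) * (R * R)).
  assert (Cx : continuous (fun p : (R * R) * (R * R) => fst (fst p)) p0)
    by (apply (continuous_comp fst fst); apply continuous_fst).
  assert (Cy : continuous (fun p : (R * R) * (R * R) => snd (fst p)) p0)
    by (apply (continuous_comp fst snd); [apply continuous_fst | apply continuous_snd]).
  assert (Cu : continuous (fun p : (R * R) * (R * R) => fst (snd p)) p0)
    by (apply (continuous_comp snd fst); [apply continuous_snd | apply continuous_fst]).
  assert (Cv : continuous (fun p : (R * R) * (R * R) => snd (snd p)) p0)
    by (apply (continuous_comp snd snd); apply continuous_snd).
  assert (Csq : forall f g : (R * R) * (R * R) -> R,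
    continuous f p0 -> continuous g p0 ->
    continuous (fun p => f p ^ 2 + g p ^ 2) p0).
  { intros f g Cf Cg.
    apply (continuous_plus (V := R_NormedModule));
      apply (continuous_comp _ (fun s => s ^ 2)); trivial;
      apply (@ex_derive_continuous R_AbsRing R_NormedModule (fun s : R => s ^ 2));
      auto_derive; exact I. }
  induction e as [k | [] | | | | e IHe f IHf | e IHe f IHf]; simpl eval; trivial.
  - apply continuous_const.
  - apply (continuous_comp _ sqrt); [ now apply Csq | apply continuous_sqrt ].
  - apply (continuous_comp _ Rinv); [ apply (continuous_comp _ sqrt) | ].
    + now apply Csq.
    + apply continuous_sqrt.
    + apply continuous_Rinv; simpl in *; lra.
  - apply (continuous_comp _ Rinv); [ apply (continuous_minus (V := R_NormedModule)) | ].
    + apply continuous_const.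
    + now apply Csq.
    + apply continuous_Rinv; simpl in *; lra.
  - now apply (continuous_plus (V := R_NormedModule)).
  - now apply (continuous_mult (K := R_AbsRing)).
Qed.

(** Openness is obtained from the continuity of the expressions x^2 + y^2 and
    u^2 + v^2. *)
Lemma slit_disc_open : forall x y u v : R, U x y u v ->
  locally ((x, y), (u, v)) (fun p : (R * R) * (R * R) =>
    U (fst (fst p)) (snd (fst p)) (fst (snd p)) (snd (snd p))).
Proof.
  intros x y u v H.
  set (base := Add (Mul (Var cx) (Var cx)) (Mul (Var cy) (Var cy))).
  set (fibre := Add (Mul (Var cu) (Var cu)) (Mul (Var cv) (Var cv))).
  pose proof (eval_continuous base x y u v H) as Cb.
  pose proof (eval_continuous fibre x y u v H) as Cf.
  destruct H as [HO HS]; unfold disc in HO; apply sum_sq_pos in HS.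
  assert (Hb : eval base x y u v < c) by (simpl; lra).
  assert (Hf : 0 < eval fibre x y u v) by (simpl; lra).
  specialize (Cb (fun w => w < c) (open_lt c _ Hb)).
  specialize (Cf (fun w => 0 < w) (open_gt 0 _ Hf)).
  unfold filtermap in Cb, Cf.
  generalize (filter_and _ _ Cb Cf).
  apply filter_imp; intros [[x' y'] [u' v']]; simpl; intros [H1 H2].
  split; [ unfold disc; lra | apply sum_sq_pos_inv; lra ].
Qed.

Lemma slit_disc_slices : forall x y u v : R, U x y u v ->
  locally x (fun s => U s y u v) /\ locally y (fun s => U x s u v) /\
  locally u (fun s => U x y s v) /\ locally v (fun s => U x y u s).
Proof.
  intros x y u v H; destruct (slit_disc_open _ _ _ _ H) as [eps He].
  split; [ | split; [ | split ] ]; exists eps; intros s Hs.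
  - apply (He ((s, y), (u, v))); repeat split; simpl; trivial; apply ball_center.
  - apply (He ((x, s), (u, v))); repeat split; simpl; trivial; apply ball_center.
  - apply (He ((x, y), (s, v))); repeat split; simpl; trivial; apply ball_center.
  - apply (He ((x, y), (u, s))); repeat split; simpl; trivial; apply ball_center.
Qed.

(** Agreement is asked for on the domain only: outside of it [Derive] takes
    arbitrary values, so the derivatives of [f] are not given by an expression
    there. Since the domain is open, agreement on it passes to derivatives. *)
Definition represents (f : R -> R -> R -> R -> R) (e : expr) : Prop :=
  forall x y u v, U x y u v -> f x y u v = eval e x y u v.

Lemma represents_is_derive : forall f e, represents f e ->
  forall x y u v, U x y u v ->
  is_derive (fun s => f s y u v) x (eval (partial cx e) x y u v) /\
  is_derive (fun s => f x s u v) y (eval (partial cy e) x y u v) /\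
  is_derive (fun s => f x y s v) u (eval (partial cu e) x y u v) /\
  is_derive (fun s => f x y u s) v (eval (partial cv e) x y u v).
Proof.
  intros f e Hf x y u v H.
  destruct (eval_is_derive e x y u v H) as (Dx & Dy & Du & Dv).
  destruct (slit_disc_slices x y u v H) as (Lx & Ly & Lu & Lv).
  split; [ | split; [ | split ] ];
    (eapply is_derive_ext_loc; [ | eassumption ]);
    (eapply filter_imp; [ | eassumption ]);
    intros s Hs; symmetry; exact (Hf _ _ _ _ Hs).
Qed.

Lemma represents_partial : forall f e, represents f e ->
  represents (dx f) (partial cx e) /\ represents (dy f) (partial cy e) /\
  represents (du f) (partial cu e) /\ represents (dv f) (partial cv e).
Proof.
  intros f e Hf; split; [ | split; [ | split ] ]; intros x y u v H;
    apply is_derive_unique; apply (represents_is_derive f e Hf x y u v H).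
Qed.

Lemma represents_smooth : forall f e, represents f e -> smooth U f.
Proof.
  intros f e Hf k; revert f e Hf; induction k as [ | k IHk ]; intros f e Hf; split; trivial.
  1, 2: intros x y u v H;
    (eapply continuous_ext_loc; [ | apply (eval_continuous e x y u v H) ]);
    (eapply filter_imp; [ | apply (slit_disc_open x y u v H) ]);
    intros p Hp; symmetry; exact (Hf _ _ _ _ Hp).
  destruct (represents_partial f e Hf) as (Hx & Hy & Hu & Hv).
  split; [ | split; [ | split; [ | split ] ] ]; try (eapply IHk; eassumption).
  intros x y u v H.
  destruct (represents_is_derive f e Hf x y u v H) as (Dx & Dy & Du & Dv).
  split; [ | split; [ | split ] ]; eexists; eassumption.
Qed.

(** * The Finsler property *)

Definition Ftau_expr (tau : R) : expr :=
  Mul (Mul (Cst (/ 2)) InvRho)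
    (Add Speed (Mul (Cst tau)
       (Add (Mul (Var cy) (Var cu)) (Mul (Cst (-1)) (Mul (Var cx) (Var cv)))))).

Lemma Ftau_represents : forall tau, represents (Ftau tau) (Ftau_expr tau).
Proof.
  intros tau x y u v [HO _]; unfold disc in HO; unfold Ftau; cbn [Ftau_expr eval]; field; lra.
Qed.

Lemma energy_represents : forall f e, represents f e ->
  represents (energy f) (Mul (Cst (/ 2)) (Mul e e)).
Proof. intros f e Hf x y u v H; unfold energy; simpl; rewrite (Hf _ _ _ _ H); field. Qed.

(** Cauchy-Schwarz bounds the square of tau (y u - x v) by
    tau^2 (x^2 + y^2) (u^2 + v^2), which is less than u^2 + v^2 on the disc. *)
Lemma Ftau_positive : forall tau x y u v, tau ^ 2 * c <= 1 -> U x y u v ->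
  0 < Ftau tau x y u v.
Proof.
  intros tau x y u v Ht [HO HS]; unfold disc in HO.
  destruct (sqrt_sum_sq _ _ HS) as [Hn Hn2]; unfold Ftau.
  set (n := sqrt _) in *.
  apply Rdiv_lt_0_compat; [ | lra ].
  pose proof (sum_sq_pos _ _ HS) as HP.
  assert (Hsq : (tau * (y * u - x * v)) ^ 2 < n ^ 2).
  { rewrite Hn2.
    assert ((tau * (y * u - x * v)) ^ 2 <= (tau ^ 2 * (x ^ 2 + y ^ 2)) * (u ^ 2 + v ^ 2)).
    { assert (0 <= (tau * (x * u + y * v)) ^ 2) by apply pow2_ge_0. nra. }
    assert (tau ^ 2 * (x ^ 2 + y ^ 2) < 1).
    { destruct (Req_dec tau 0) as [-> | Ht0]; [ lra | ].
      assert (0 < tau ^ 2) by nra. nra. }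
    nra. }
  nra.
Qed.

(** The Hessian of F^2/2 is the square of the differential of F plus F times the
    Hessian of F; the latter comes from the norm alone and is a positive multiple
    of the square of A = v a - u b. If A = 0 then Lagrange's identity
    shows u a + v b <> 0, and Euler's identity makes the differential of F
    nonzero on (a, b). *)
Lemma Ftau_strongly_convex : forall tau, tau ^ 2 * c <= 1 ->
  strongly_convex (disc c) (Ftau tau).
Proof.
  intros tau Ht x y u v H a b Hab.
  destruct (represents_partial _ _ (energy_represents _ _ (Ftau_represents tau)))
    as (_ & _ & Hu & Hv).
  destruct (represents_partial _ _ Hu) as (_ & _ & Huu & Hvu).
  destruct (represents_partial _ _ Hv) as (_ & _ & Huv & Hvv).
  rewrite (Huu _ _ _ _ H), (Hvu _ _ _ _ H), (Huv _ _ _ _ H), (Hvv _ _ _ _ H).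
  pose proof (Ftau_positive tau x y u v Ht H) as HF.
  destruct H as [HO HS]; unfold disc in HO.
  destruct (sqrt_sum_sq _ _ HS) as [Hn Hn2].
  unfold Ftau in HF; cbn [Ftau_expr eval partial delta].
  set (n := sqrt (u ^ 2 + v ^ 2)) in *.
  set (r := 1 - (x ^ 2 + y ^ 2)) in *.
  assert (Hr : 0 < r) by (unfold r; lra).
  set (F := (n + tau * (y * u - x * v)) / (2 * r)) in *.
  set (Fu := (u / n + tau * y) / (2 * r)).
  set (Fv := (v / n - tau * x) / (2 * r)).
  set (L := Fu * a + Fv * b).
  set (A := v * a - u * b).
  match goal with |- 0 < ?Q =>
    assert (E : Q = L ^ 2 + F * (A ^ 2 / (n ^ 3 * (2 * r)))) end.
  { unfold L, Fu, Fv, F, A.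
    field_simplify_eq; [ | lra ].
    replace (n ^ 4) with ((n ^ 2) ^ 2) by ring.
    replace (n ^ 3) with (n ^ 2 * n) by ring.
    rewrite Hn2. ring. }
  rewrite E; clear E.
  assert (Hd : 0 < n ^ 3 * (2 * r)) by (apply Rmult_lt_0_compat; [ apply pow_lt | ]; lra).
  assert (HA : 0 <= A ^ 2 / (n ^ 3 * (2 * r))).
  { apply Rdiv_le_0_compat; [ apply pow2_ge_0 | exact Hd ]. }
  destruct (Req_dec A 0) as [HA0 | HA0].
  - assert (HL : (u ^ 2 + v ^ 2) * L = (u * a + v * b) * F).
    { assert (Euler : F = u * Fu + v * Fv).
      { unfold F, Fu, Fv; field_simplify_eq; [ | lra ]. rewrite Hn2; ring. }
      rewrite Euler; unfold L.
      replace ((u ^ 2 + v ^ 2) * (Fu * a + Fv * b))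
        with ((u * a + v * b) * (u * Fu + v * Fv) + A * (v * Fu - u * Fv))
        by (unfold A; ring).
      rewrite HA0; ring. }
    assert (Hk : u * a + v * b <> 0).
    { intro Hk.
      assert (HP := sum_sq_pos _ _ HS); assert (HQ := sum_sq_pos _ _ Hab).
      assert ((u ^ 2 + v ^ 2) * (a ^ 2 + b ^ 2) = 0).
      { replace ((u ^ 2 + v ^ 2) * (a ^ 2 + b ^ 2))
          with ((u * a + v * b) ^ 2 + A ^ 2) by (unfold A; ring).
        rewrite Hk, HA0; ring. }
      nra. }
    assert (L <> 0).
    { intros HL0; rewrite HL0 in HL.
      assert ((u * a + v * b) * F <> 0) by (apply Rmult_integral_contrapositive; lra).
      lra. }
    assert (0 < L ^ 2) by (now apply pow2_gt_0).
    assert (0 <= F * (A ^ 2 / (n ^ 3 * (2 * r)))) by (apply Rmult_le_pos; lra).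
    lra.
  - assert (0 < F * (A ^ 2 / (n ^ 3 * (2 * r)))).
    { apply Rmult_lt_0_compat; [ exact HF | ].
      apply Rdiv_lt_0_compat; [ now apply pow2_gt_0 | exact Hd ]. }
    pose proof (pow2_ge_0 L); lra.
Qed.

Lemma Ftau_homogeneous : forall tau x y u v l, 0 < l ->
  Ftau tau x y (l * u) (l * v) = l * Ftau tau x y u v.
Proof.
  intros tau x y u v l Hl; unfold Ftau.
  replace ((l * u) ^ 2 + (l * v) ^ 2) with (l ^ 2 * (u ^ 2 + v ^ 2)) by ring.
  rewrite sqrt_mult_alt by apply pow2_ge_0.
  rewrite sqrt_pow2 by lra.
  unfold Rdiv; ring.
Qed.

Lemma Ftau_is_Finsler : forall tau, tau ^ 2 * c <= 1 -> is_Finsler (disc c) (Ftau tau).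
Proof.
  intros tau Ht; split.
  - exact (represents_smooth _ _ (Ftau_represents tau)).
  - intros x y u v l _; apply Ftau_homogeneous.
  - intros x y u v; now apply Ftau_positive.
  - now apply Ftau_strongly_convex.
Qed.

End Disc.

(** * Derivatives along a curve *)

Lemma sqrt_swap : forall u v : R, sqrt (v ^ 2 + u ^ 2) = sqrt (u ^ 2 + v ^ 2).
Proof. intros u v; f_equal; ring. Qed.

(** The Frenet equation. Exchanging [f] and [g] changes the sign of the curvature
    (f g' - g f') / n^3, so the same lemma gives the second component. *)
Lemma unit_vector_derive : forall (f g : R -> R) (t f' g' : R),
  (f t, g t) <> (0, 0) -> is_derive f t f' -> is_derive g t g' ->
  is_derive (fun s => f s / sqrt (f s ^ 2 + g s ^ 2)) t
    (- (((f t * g' - g t * f') / sqrt (f t ^ 2 + g t ^ 2) ^ 3) * g t)).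
Proof.
  intros f g t f' g' H Df Dg.
  destruct (sqrt_sum_sq _ _ H) as [Hn Hn2]; apply sum_sq_pos in H.
  auto_derive.
  - repeat split; try (eexists; eassumption); simpl in *; lra.
  - replace (Derive (fun s => f s) t) with f' by (symmetry; now apply is_derive_unique).
    replace (Derive (fun s => g s) t) with g' by (symmetry; now apply is_derive_unique).
    change (sqrt (f t * (f t * 1) + g t * (g t * 1))) with (sqrt (f t ^ 2 + g t ^ 2)).
    set (n := sqrt _) in *.
    field_simplify_eq; [ | lra ].
    rewrite Hn2; ring.
Qed.

(** The momenta du F and dv F of [Ftau] along a curve have this form, where T is a
    component of the Euclidean unit tangent, with z = y, k = tau for the first
    and z = x, k = - tau for the second. *)
Lemma momentum_derive : forall (x y T z : R -> R) (t k x' y' T' z' : R),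
  D0 (x t) (y t) ->
  is_derive x t x' -> is_derive y t y' -> is_derive T t T' -> is_derive z t z' ->
  is_derive (fun s => (T s + k * z s) / (2 * (1 - (x s ^ 2 + y s ^ 2)))) t
    ((T' + k * z') / (2 * (1 - (x t ^ 2 + y t ^ 2)))
     + (T t + k * z t) * (x t * x' + y t * y') / (1 - (x t ^ 2 + y t ^ 2)) ^ 2).
Proof.
  intros x y T z t k x' y' T' z' H Dx Dy DT Dz; unfold D0 in H.
  auto_derive.
  - repeat split; try (eexists; eassumption); lra.
  - replace (Derive (fun s => x s) t) with x' by (symmetry; now apply is_derive_unique).
    replace (Derive (fun s => y s) t) with y' by (symmetry; now apply is_derive_unique).
    replace (Derive (fun s => T s) t) with T' by (symmetry; now apply is_derive_unique).
    replace (Derive (fun s => z s) t) with z' by (symmetry; now apply is_derive_unique).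
    field; lra.
Qed.

(** The momenta and forces that enter the Euler-Lagrange equations. *)
Lemma Ftau_partials : forall tau x y u v, slit D0 x y u v ->
  let n := sqrt (u ^ 2 + v ^ 2) in
  let r := 1 - (x ^ 2 + y ^ 2) in
  dx (Ftau tau) x y u v = - tau * v / (2 * r) + (n + tau * (y * u - x * v)) * x / r ^ 2 /\
  dy (Ftau tau) x y u v = tau * u / (2 * r) + (n + tau * (y * u - x * v)) * y / r ^ 2 /\
  du (Ftau tau) x y u v = (u / n + tau * y) / (2 * r) /\
  dv (Ftau tau) x y u v = (v / n + - tau * x) / (2 * r).
Proof.
  intros tau x y u v H n r.
  destruct (represents_partial 1 (Rle_refl 1) _ _ (Ftau_represents 1 (Rle_refl 1) tau))
    as (Hx & Hy & Hu & Hv).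
  rewrite (Hx _ _ _ _ H), (Hy _ _ _ _ H), (Hu _ _ _ _ H), (Hv _ _ _ _ H).
  destruct H as [HO HS]; unfold D0 in HO; destruct (sqrt_sum_sq _ _ HS) as [Hn _].
  cbn [Ftau_expr eval partial delta]; unfold n, r in *; clear n r.
  repeat split; field; lra.
Qed.

(** * The Levi-Civita connection of the Poincaré metric *)

Definition kron (i j : coord) : R :=
  match i, j with X, X | Y, Y => 1 | _, _ => 0 end.

Definition pos (x y : R) (i : coord) : R := match i with X => x | Y => y end.

Lemma poincare_partial : forall i j l x y, D0 x y ->
  dcoord i (poincare j l) x y
  = kron j l * (16 * pos x y i / (1 - (x ^ 2 + y ^ 2)) ^ 3).
Proof.
  intros i j l x y H; unfold D0 in H.
  assert (Hr : (1 - (x ^ 2 + y ^ 2)) <> 0) by lra.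
  destruct i, j, l; cbn [dcoord poincare kron pos]; rewrite ?Derive_const; try ring;
    apply is_derive_unique; auto_derive;
    try (field; lra); now repeat apply Rmult_integral_contrapositive_currified; lra.
Qed.

(** For a conformal metric e^(2 s) (dx^2 + dy^2) the symbol Gamma^k_ij is
    kron k j * d_i s + kron k i * d_j s - kron i j * d_k s; here s = ln (2/rho)
    has gradient 2 (x, y) / rho. *)
Lemma poincare_christoffel : forall k i j x y, D0 x y ->
  christoffel poincare k i j x y
  = 2 / (1 - (x ^ 2 + y ^ 2))
    * (kron k j * pos x y i + kron k i * pos x y j - kron i j * pos x y k).
Proof.
  intros k i j x y H; unfold christoffel, sumc; rewrite !poincare_partial by exact H.
  unfold D0 in H.
  destruct i, j, k; unfold metric_inv, metric_det, poincare, kron, pos; field; lra.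
Qed.

Lemma poincare_gnorm : forall x y v, D0 x y ->
  gnorm poincare x y v = 2 * sqrt (v X ^ 2 + v Y ^ 2) / (1 - (x ^ 2 + y ^ 2)).
Proof.
  intros x y v H; unfold D0 in H; unfold gnorm, inner, sumc, poincare.
  replace (_ + _) with ((2 / (1 - (x ^ 2 + y ^ 2))) ^ 2 * (v X ^ 2 + v Y ^ 2)) by (field; lra).
  rewrite sqrt_mult_alt by apply pow2_ge_0.
  rewrite sqrt_pow2 by (apply Rdiv_le_0_compat; lra).
  field; lra.
Qed.

(** * Geodesics *)

Section Geodesic.

Variables (tau : R) (a b : Rbar) (x y : R -> R).
Hypothesis geo : is_geodesic D0 (Ftau tau) a b x y.

Let I (t : R) : Prop := Rbar_lt a t /\ Rbar_lt t b.
Let speed (t : R) : R := sqrt (Derive x t ^ 2 + Derive y t ^ 2).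
Let tx (t : R) : R := Derive x t / speed t.
Let ty (t : R) : R := Derive y t / speed t.
Let rho (t : R) : R := 1 - (x t ^ 2 + y t ^ 2).
(* The Euclidean curvature that the Euler-Lagrange equations prescribe in terms
   of position and direction. *)
Let kappa (t : R) : R := 2 * (tau + y t * tx t - x t * ty t) / rho t.

Lemma interval_open : forall t, I t -> locally t I.
Proof.
  intros t [Ha Hb].
  exact (filter_and _ _ (open_Rbar_gt' t a Ha) (open_Rbar_lt' t b Hb)).
Qed.

Lemma constant_on_interval : forall f : R -> R,
  (forall t, I t -> is_derive f t 0) -> forall s t, I s -> I t -> f s = f t.
Proof.
  intros f Hf.
  assert (Hlt : forall s t, I s -> I t -> s < t -> f s = f t).
  { intros s t [Hs _] [_ Ht] Hst; apply eq_is_derive; trivial.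
    intros r Hr; apply Hf; split.
    - apply (Rbar_lt_le_trans _ s); [ exact Hs | exact (proj1 Hr) ].
    - apply (Rbar_le_lt_trans _ t); [ exact (proj2 Hr) | exact Ht ]. }
  intros s t Hs Ht; destruct (Rtotal_order s t) as [H | [-> | H]]; auto.
  symmetry; auto.
Qed.

Lemma position_derive : forall t, I t ->
  is_derive x t (Derive x t) /\ is_derive y t (Derive y t).
Proof.
  intros t [Ha Hb]; destruct (geodesic_regularity _ _ _ _ _ _ geo t Ha Hb) as (Hx & Hy & _).
  split; now apply Derive_correct.
Qed.

Lemma lift_in_slit : forall t, I t -> slit D0 (x t) (y t) (Derive x t) (Derive y t).
Proof. intros t [Ha Hb]; exact (geodesic_slit _ _ _ _ _ _ geo t Ha Hb). Qed.

(** The actual Euclidean curvature k is compared with [kappa]. Each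
    Euler-Lagrange equation, multiplied by 2 rho^2, says up to sign that a
    component of the velocity times k rho - 2 (tau + y T1 - x T2) is zero; one
    of the two components is not. *)
Lemma tangent_derive : forall t, I t ->
  is_derive tx t (- (kappa t * Derive y t)) /\ is_derive ty t (kappa t * Derive x t).
Proof.
  intros t Ht; pose proof Ht as [Ha Hb].
  destruct (geodesic_regularity _ _ _ _ _ _ geo t Ha Hb) as (_ & _ & Hxx & Hyy).
  apply Derive_correct in Hxx; apply Derive_correct in Hyy.
  destruct (position_derive t Ht) as [Dx Dy].
  pose proof (lift_in_slit t Ht) as Hs; pose proof Hs as [HD HS].
  set (k := (Derive x t * Derive (Derive y) t - Derive y t * Derive (Derive x) t)
            / speed t ^ 3).
  assert (Dtx : is_derive tx t (- (k * Derive y t)))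
    by exact (unit_vector_derive (Derive x) (Derive y) t _ _ HS Hxx Hyy).
  assert (Dty : is_derive ty t (k * Derive x t)).
  { apply is_derive_ext with (fun s => Derive y s / sqrt (Derive y s ^ 2 + Derive x s ^ 2)).
    { intros s; unfold ty, speed; now rewrite sqrt_swap. }
    replace (k * Derive x t) with
      (- ((Derive y t * Derive (Derive x) t - Derive x t * Derive (Derive y) t)
            / sqrt (Derive y t ^ 2 + Derive x t ^ 2) ^ 3 * Derive x t)).
    { apply unit_vector_derive; trivial. intros E; apply HS; congruence. }
    rewrite sqrt_swap; unfold k, speed, Rdiv; ring. }
  assert (Ex : is_derive (fun s => (tx s + tau * y s) / (2 * (1 - (x s ^ 2 + y s ^ 2)))) t
                 (dx (Ftau tau) (x t) (y t) (Derive x t) (Derive y t))).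
  { eapply is_derive_ext_loc; [ | exact (geodesic_Euler_Lagrange_x _ _ _ _ _ _ geo t Ha Hb) ].
    eapply filter_imp; [ | exact (interval_open t Ht) ]; intros s Is.
    apply (Ftau_partials tau _ _ _ _ (lift_in_slit s Is)). }
  assert (Ey : is_derive (fun s => (ty s + - tau * x s) / (2 * (1 - (x s ^ 2 + y s ^ 2)))) t
                 (dy (Ftau tau) (x t) (y t) (Derive x t) (Derive y t))).
  { eapply is_derive_ext_loc; [ | exact (geodesic_Euler_Lagrange_y _ _ _ _ _ _ geo t Ha Hb) ].
    eapply filter_imp; [ | exact (interval_open t Ht) ]; intros s Is.
    apply (Ftau_partials tau _ _ _ _ (lift_in_slit s Is)). }
  pose proof (momentum_derive _ _ _ _ t tau _ _ _ _ HD Dx Dy Dtx Dy) as Mx.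
  pose proof (momentum_derive _ _ _ _ t (- tau) _ _ _ _ HD Dx Dy Dty Dx) as My.
  apply is_derive_unique in Ex; apply is_derive_unique in Mx; rewrite Ex in Mx; clear Ex.
  apply is_derive_unique in Ey; apply is_derive_unique in My; rewrite Ey in My; clear Ey.
  destruct (Ftau_partials tau _ _ _ _ Hs) as (Fx & Fy & _ & _).
  rewrite Fx in Mx; rewrite Fy in My; clear Fx Fy.
  destruct (sqrt_sum_sq _ _ HS) as [Hn Hn2]; unfold D0 in HD.
  enough (E : k = kappa t) by (rewrite <- E; now split).
  fold (speed t) in *.
  unfold kappa, tx, ty in *; fold (rho t) in *.
  assert (Hr : 0 < rho t) by (unfold rho; lra).
  set (n := speed t) in *; set (u := Derive x t) in *; set (v := Derive y t) in *.
  assert (Zx : v * (k * rho t - 2 * (tau + y t * (u / n) - x t * (v / n))) = 0).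
  { match type of Mx with ?l = ?r => transitivity (2 * rho t ^ 2 * (l - r)) end.
    - field_simplify_eq; [ | lra ]. rewrite Hn2; unfold rho; ring.
    - rewrite Mx; ring. }
  assert (Zy : u * (k * rho t - 2 * (tau + y t * (u / n) - x t * (v / n))) = 0).
  { match type of My with ?l = ?r => transitivity (- 2 * rho t ^ 2 * (l - r)) end.
    - field_simplify_eq; [ | lra ]. rewrite Hn2; unfold rho; ring.
    - rewrite My; ring. }
  destruct (Req_dec (k * rho t) (2 * (tau + y t * (u / n) - x t * (v / n)))) as [E | E].
  - rewrite <- E; field; lra.
  - apply Rminus_eq_contra in E.
    elim HS.
    destruct (Rmult_integral _ _ Zx) as [-> | Z]; [ | contradiction ].
    destruct (Rmult_integral _ _ Zy) as [-> | Z]; [ reflexivity | contradiction ].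
Qed.

(** In the derivative of kappa * rho = 2 (tau + y T1 - x T2) the terms
    y' T1 - x' T2 cancel, and what remains on the right is
    - 2 kappa (x x' + y y') = kappa * rho'. *)
Lemma kappa_constant : forall s t, I s -> I t -> kappa s = kappa t.
Proof.
  apply constant_on_interval; intros t Ht.
  destruct (position_derive t Ht) as [Dx Dy].
  destruct (tangent_derive t Ht) as [Dtx Dty].
  destruct (lift_in_slit t Ht) as [HD HS]; unfold D0 in HD.
  destruct (sqrt_sum_sq _ _ HS) as [Hn _]; fold (speed t) in Hn.
  assert (Hr : rho t <> 0) by (unfold rho; lra).
  assert (Ht_x : tx t * speed t = Derive x t) by (unfold tx; field; lra).
  assert (Ht_y : ty t * speed t = Derive y t) by (unfold ty; field; lra).
  assert (Hk : kappa t * rho t = 2 * (tau + y t * tx t - x t * ty t))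
    by (unfold kappa; field; exact Hr).
  unfold kappa, rho.
  auto_derive.
  - repeat split; try (eexists; eassumption); exact Hr.
  - replace (Derive (fun s => x s) t) with (Derive x t) by reflexivity.
    replace (Derive (fun s => y s) t) with (Derive y t) by reflexivity.
    replace (Derive (fun s => tx s) t) with (- (kappa t * Derive y t))
      by (symmetry; now apply is_derive_unique).
    replace (Derive (fun s => ty s) t) with (kappa t * Derive x t)
      by (symmetry; now apply is_derive_unique).
    change (1 + - (x t * (x t * 1) + y t * (y t * 1))) with (rho t).
    generalize dependent (kappa t); intros k _ _ Hk.
    replace (2 * (tau + y t * tx t + - (x t * ty t))) with (k * rho t) by lra.
    rewrite <- Ht_x, <- Ht_y; field; exact Hr.
Qed.

(** A geodesic of Euclidean curvature 0 keeps its tangent direction; otherwise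
    the centre of its osculating circle does not move. *)
Lemma geodesic_is_circle : is_circle a b x y.
Proof.
  destruct (Classical_Prop.classic (exists t0, I t0)) as [[t0 H0] | Hempty].
  (* A curve without points lies on any line. *)
  2: { right; exists 1, 0, 0; split.
    - intros E; injection E; lra.
    - intros t Ha Hb; elim Hempty; exists t; now split. }
  destruct (Req_dec (kappa t0) 0) as [Hk | Hk].
  - assert (HT : forall t, I t -> tx t = tx t0 /\ ty t = ty t0).
    { intros t Ht; split; apply constant_on_interval; trivial; intros s Hs;
        destruct (tangent_derive s Hs) as [Dtx Dty];
        rewrite (kappa_constant s t0 Hs H0), Hk in Dtx, Dty.
      - now replace 0 with (- (0 * Derive y s)) by ring.
      - now replace 0 with (0 * Derive x s) by ring. }
    right; exists (ty t0), (- tx t0), (tx t0 * y t0 - ty t0 * x t0).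
    destruct (lift_in_slit t0 H0) as [_ HS].
    destruct (sqrt_sum_sq _ _ HS) as [Hn _]; fold (speed t0) in Hn.
    split.
    + intros E; injection E; intros E1 E2; apply HS; f_equal.
      * replace (Derive x t0) with (- - tx t0 * speed t0) by (unfold tx; field; lra).
        rewrite E1; ring.
      * replace (Derive y t0) with (ty t0 * speed t0) by (unfold ty; field; lra).
        rewrite E2; ring.
    + intros t Ha Hb.
      assert (E : ty t0 * x t - tx t0 * y t = ty t0 * x t0 - tx t0 * y t0).
      { apply (constant_on_interval (fun s => ty t0 * x s - tx t0 * y s));
          [ | now split | trivial ].
        intros s Hs; destruct (position_derive s Hs) as [Dx Dy].
        destruct (HT s Hs) as [<- <-].
        destruct (lift_in_slit s Hs) as [_ HS'].
        destruct (sqrt_sum_sq _ _ HS') as [Hn' _]; fold (speed s) in Hn'.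
        replace 0 with (ty s * Derive x s - tx s * Derive y s)
          by (unfold tx, ty; field; lra).
        refine (is_derive_minus _ _ _ _ _ _ _); now apply is_derive_scal. }
      lra.
  - left; exists (x t0 - ty t0 / kappa t0), (y t0 + tx t0 / kappa t0), (/ Rabs (kappa t0)).
    split; [ now apply Rinv_0_lt_compat, Rabs_pos_lt | ].
    intros t Ha Hb.
    assert (Ht : I t) by now split.
    assert (Ep : x t0 - ty t0 / kappa t0 = x t - ty t / kappa t0).
    { apply (constant_on_interval (fun s => x s - ty s / kappa t0)); trivial.
      intros s Hs; destruct (position_derive s Hs) as [Dx Dy].
      destruct (tangent_derive s Hs) as [_ Dty].
      rewrite (kappa_constant s t0 Hs H0) in Dty.
      auto_derive; [ split; [ | split ]; trivial; eexists; eassumption | ].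
      replace (Derive (fun s => ty s) s) with (kappa t0 * Derive x s)
        by (symmetry; now apply is_derive_unique).
      change (Derive (fun s => x s) s) with (Derive x s).
      field; exact Hk. }
    assert (Eq : y t0 + tx t0 / kappa t0 = y t + tx t / kappa t0).
    { apply (constant_on_interval (fun s => y s + tx s / kappa t0)); trivial.
      intros s Hs; destruct (position_derive s Hs) as [Dx Dy].
      destruct (tangent_derive s Hs) as [Dtx _].
      rewrite (kappa_constant s t0 Hs H0) in Dtx.
      auto_derive; [ split; [ | split ]; trivial; eexists; eassumption | ].
      replace (Derive (fun s => tx s) s) with (- (kappa t0 * Derive y s))
        by (symmetry; now apply is_derive_unique).
      change (Derive (fun s => y s) s) with (Derive y s).
      field; exact Hk. }
    rewrite Ep, Eq, pow_inv, pow2_abs.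
    destruct (lift_in_slit t Ht) as [_ HS].
    destruct (sqrt_sum_sq _ _ HS) as [Hn Hn2]; fold (speed t) in Hn, Hn2.
    assert (Hunit : tx t ^ 2 + ty t ^ 2 = 1).
    { unfold tx, ty; field_simplify_eq; [ symmetry; exact Hn2 | lra ]. }
    transitivity ((tx t ^ 2 + ty t ^ 2) / kappa t0 ^ 2); [ | rewrite Hunit ];
      field; exact Hk.
Qed.

Lemma poincare_unit_tangent : forall t, I t ->
  unit_tangent poincare x y t X = tx t * rho t / 2 /\
  unit_tangent poincare x y t Y = ty t * rho t / 2.
Proof.
  intros t Ht; destruct (lift_in_slit t Ht) as [HD HS].
  unfold unit_tangent; rewrite poincare_gnorm by exact HD.
  destruct (sqrt_sum_sq _ _ HS) as [Hn _]; unfold D0 in HD.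
  unfold tx, ty, speed, rho; cbn [velocity].
  split; field; lra.
Qed.

Lemma scaled_tangent_derive : forall (f : R -> R) (t f' : R), I t -> is_derive f t f' ->
  is_derive (fun s => f s * rho s / 2) t
    (f' * rho t / 2 - f t * (x t * Derive x t + y t * Derive y t)).
Proof.
  intros f t f' Ht Df; destruct (position_derive t Ht) as [Dx Dy].
  unfold rho; auto_derive.
  - repeat split; eexists; eassumption.
  - replace (Derive (fun s => f s) t) with f' by (symmetry; now apply is_derive_unique).
    change (Derive (fun s => x s) t) with (Derive x t).
    change (Derive (fun s => y s) t) with (Derive y t).
    field.
Qed.

(** Expanding the covariant derivative of the unit tangent gives the conformal
    change formula k_g = (kappa * rho) / 2 + x T2 - y T1, which is tau by the
    definition of [kappa]. *)
Lemma geodesic_poincare_curvature : forall t, I t ->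
  geodesic_curvature poincare x y t = tau.
Proof.
  intros t Ht.
  destruct (tangent_derive t Ht) as [Dtx Dty].
  assert (DX : Derive (fun s => unit_tangent poincare x y s X) t =
    - (kappa t * Derive y t) * rho t / 2 - tx t * (x t * Derive x t + y t * Derive y t)).
  { apply is_derive_unique.
    apply is_derive_ext_loc with (fun s => tx s * rho s / 2).
    - eapply filter_imp; [ | exact (interval_open t Ht) ]; intros s Hs.
      symmetry; apply (poincare_unit_tangent s Hs).
    - now apply scaled_tangent_derive. }
  assert (DY : Derive (fun s => unit_tangent poincare x y s Y) t =
    kappa t * Derive x t * rho t / 2 - ty t * (x t * Derive x t + y t * Derive y t)).
  { apply is_derive_unique.
    apply is_derive_ext_loc with (fun s => ty s * rho s / 2).
    - eapply filter_imp; [ | exact (interval_open t Ht) ]; intros s Hs.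
      symmetry; apply (poincare_unit_tangent s Hs).
    - now apply scaled_tangent_derive. }
  destruct (poincare_unit_tangent t Ht) as [UX UY].
  destruct (lift_in_slit t Ht) as [HD HS].
  destruct (sqrt_sum_sq _ _ HS) as [Hn Hn2].
  unfold geodesic_curvature, unit_normal.
  rewrite !poincare_gnorm by exact HD.
  unfold inner, cov_deriv, sumc.
  rewrite DX, DY, UX, UY, !poincare_christoffel by exact HD.
  cbn [poincare kron pos velocity rot].
  replace ((- Derive y t) ^ 2 + Derive x t ^ 2)
    with (Derive x t ^ 2 + Derive y t ^ 2) by ring.
  fold (speed t) in *; fold (rho t).
  assert (Hr : 0 < rho t) by (unfold D0 in HD; unfold rho; lra).
  assert (Hk : kappa t * rho t = 2 * (tau + y t * tx t - x t * ty t))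
    by (unfold kappa; field; lra).
  assert (Hx : Derive x t = tx t * speed t) by (unfold tx; field; lra).
  assert (Hy : Derive y t = ty t * speed t) by (unfold ty; field; lra).
  assert (Hunit : tx t ^ 2 + ty t ^ 2 = 1).
  { unfold tx, ty; field_simplify_eq; [ symmetry; exact Hn2 | lra ]. }
  rewrite Hx, Hy.
  transitivity ((tx t ^ 2 + ty t ^ 2) * (kappa t * rho t / 2 + x t * ty t - y t * tx t)).
  - field; lra.
  - rewrite Hunit, Hk; field.
Qed.

End Geodesic.

Theorem mainTheorem3 :
  forall tau : R,
    (-1 <= tau <= 1 -> is_Finsler D0 (Ftau tau)) /\
    (1 < Rabs tau ->
       is_Finsler (fun x y => x ^ 2 + y ^ 2 < / tau ^ 2) (Ftau tau)) /\
    (forall (a b : Rbar) (x y : R -> R),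
       is_geodesic D0 (Ftau tau) a b x y ->
       is_circle a b x y /\
       (forall t : R, Rbar_lt a t -> Rbar_lt t b ->
          geodesic_curvature poincare x y t = tau)).
Proof.
  intros tau; split; [ | split ].
  - intros Ht; apply (Ftau_is_Finsler 1 (Rle_refl 1)); nra.
  - intros Ht.
    assert (H1 : 1 < tau ^ 2) by (rewrite <- pow2_abs; nra).
    apply (Ftau_is_Finsler (/ tau ^ 2)).
    + rewrite <- Rinv_1; apply Rinv_le_contravar; lra.
    + right; field; intros ->; lra.
  - intros a b x y geo; split.
    + exact (geodesic_is_circle tau a b x y geo).
    + intros t Ha Hb; exact (geodesic_poincare_curvature tau a b x y geo t (conj Ha Hb)).
Qed.
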